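(* Let $0<\beta<\alpha<\mu\le 1$ and let the kernel $k$ satisfy the kernel regularity assumption with exponent $\mu$ given in the context. Let $\lambda\in\mathbb C$ and $A=I-\lambda K$. Then for every $v\in X_\beta$ and every $t_j^d\in\mathcal D$, $$[Av]_{t_j^d}=[v]_{t_j^d}.$$ Consequently, if $\varphi\in X_\beta$ is a solution of $A\varphi=f$, then $$[\varphi]_{t_j^d}=[f]_{t_j^d},\qquad j=1,\ldots,n_d.$$
   Context: **Contour.** $\Gamma\subset\mathbb C$ is a simple, closed, positively oriented contour of class $C^2$ with a regular $C^2$, $2\pi$-periodic parametrization $\gamma:\mathbb R\to\Gamma$ (so $\gamma(\theta+2\pi)=\gamma(\theta)$, $\gamma'(\theta)\ne0$, $\gamma$ injective on $[0,2\pi)$). $\mathcal D=\{t_1^d,\ldots,t_{n_d}^d\}\subset\Gamma$, $n_d\ge1$, is a set of distinct points, $t_j^d=\gamma(\theta_j^d)$ with $0<\theta_1^d<\cdots<\theta_{n_d}^d<2\pi$; the point $t_*=\gamma(0)=\gamma(2\pi)\notin\mathcal D$ is the cut. The continuity arcs are the $n_d$ open arcs of $\Gamma\setminus\mathcal D$. For a function $v$ with one-sided limits, $v(t_j^d\pm0)$ denote the limits along the orientation ($-$: incoming, $+$: outgoing), $[v]_{t_j^d}:=v(t_j^d+0)-v(t_j^d-0)$, and functions are represented by incoming values $v(t_j^d)=v(t_j^d-0)$. **Spaces.** For $0<\sigma<1$, $X_\sigma=PH_\sigma(\Gamma,\mathcal D)$ is the space of complex functions that are $\sigma$-Hölder on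 every continuity arc and have finite lateral limits at all points of $\mathcal D$, with norm $\|v\|_{X_\sigma}=\max_I(\|v\|_{\infty,I}+[v]_{\sigma,I})$, the maximum over the continuity arcs $I$; here $\overline I^{\,\ell}$ is $I$ completed by its two endpoints carrying the lateral values, $\|v\|_{\infty,I}=\sup_{\overline I^{\,\ell}}|v|$ and $[v]_{\sigma,I}=\sup_{t\ne s\in\overline I^{\,\ell}}|v(t)-v(s)|/|t-s|^\sigma$. If $n_d=1$, the distance $|t-s|$ in this seminorm is understood as the distance along the (single) completed arc. **Kernel regularity assumption.** There are constants $M_0,M_\mu$ with $|k(t,\tau)|\le M_0$ and $|k(t,\tau)-k(s,\tau)|\le M_\mu|t-s|^\mu$ for all $t,s,\tau\in\Gamma$, and a modulus of continuity $\omega_k$ with $\omega_k(r)\to0$ as $r\downarrow0$ such that $|k(t,\tau)-k(t,\zeta)|\le\omega_k(|\tau-\zeta|)$ for all $t,\tau,\zeta\in\Gamma$. **Operator.** $(Kv)(t)=\int_\Gamma k(t,\tau)v(\tau)\,d\tau$ (complex contour integral). *)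

(* Defs.v *)
(* The complex plane is Coquelicot's C, normed by Cmod; curves are differentiated
   and contour integrals computed with C seen as a normed module over R. *)
From Stdlib Require Import Reals.
From Coquelicot Require Import Coquelicot.

Open Scope R_scope.

Definition winding_number (g dg : R -> C) (z : C) : C :=
  (/ (RtoC (2 * PI) * Ci) *
   RInt (V := C_R_CompleteNormedModule) (fun th => dg th / (g th - z)) 0 (2 * PI))%C.

(* z lies in the bounded component of the complement of the curve: the complement
   is open, so its components are path components. *)
Definition enclosed (g : R -> C) (z : C) : Prop :=
  (forall th, g th <> z) /\
  exists M : R, forall p : R -> C,
    (forall s, continuous p s) -> p 0 = z ->
    (forall s th, 0 <= s <= 1 -> g th <> p s) ->
    Cmod (p 1) <= M.

Record contour : Type := Contour {
  gam :> R -> C;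
  dgam : R -> C;
  ddgam : R -> C;
  gam_derive : forall th, is_derive (V := C_R_NormedModule) gam th (dgam th);
  dgam_derive : forall th, is_derive (V := C_R_NormedModule) dgam th (ddgam th);
  ddgam_continuous : forall th, continuous ddgam th;
  gam_periodic : forall th, gam (th + 2 * PI) = gam th;
  gam_regular : forall th, dgam th <> RtoC 0;
  gam_simple : forall a b, 0 <= a < 2 * PI -> 0 <= b < 2 * PI -> gam a = gam b -> a = b;
  gam_positive : forall z, enclosed gam z -> winding_number gam dgam z = RtoC 1
}.

Definition on_contour (G : contour) (t : C) : Prop := exists th, t = G th.

(* The points of D are G (angle 1), ..., G (angle nd); other values of angle are
   irrelevant. *)
Record jump_set : Type := JumpSet {
  nd : nat;
  angle : nat -> R;
  nd_pos : (1 <= nd)%nat;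
  angle_gt0 : 0 < angle 1;
  angle_incr : forall j, (1 <= j < nd)%nat -> angle j < angle (S j);
  angle_lt : angle nd < 2 * PI
}.

(* The j-th continuity arc is the image of the open interval (angle j, arc_end j);
   the last one crosses the cut G 0 = G (2 * PI). *)
Definition arc_end (D : jump_set) (j : nat) : R :=
  if Nat.eqb j (nd D) then angle D 1 + 2 * PI else angle D (S j).

Definition in_arc (D : jump_set) (j : nat) (th : R) : Prop :=
  angle D j < th < arc_end D j.

(* Distance between the points of parameters a, b of one arc: arc length if D is a
   singleton, chord length otherwise. *)
Definition arc_dist (G : contour) (D : jump_set) (a b : R) : R :=
  if Nat.eqb (nd D) 1
  then Rabs (RInt (fun th => Cmod (dgam G th)) a b)
  else Cmod (G a - G b)%C.

(* x ^ s for 0 <= x and 0 < s; Stdlib's Rpower has Rpower 0 s = 1. *)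
Definition rpow (x s : R) : R := if Req_EM_T x 0 then 0 else Rpower x s.

Definition is_incoming (G : contour) (v : C -> C) (th : R) (l : C) : Prop :=
  filterlim (fun x => v (G x)) (at_left th) (locally l).

Definition is_outgoing (G : contour) (v : C -> C) (th : R) (l : C) : Prop :=
  filterlim (fun x => v (G x)) (at_right th) (locally l).

(* iota P is the unique element satisfying P, as in the definition of RInt; these
   are meaningful only under ex_lateral. *)
Definition incoming (G : contour) (v : C -> C) (th : R) : C :=
  iota (T := C_R_CompleteNormedModule) (is_incoming G v th).

Definition outgoing (G : contour) (v : C -> C) (th : R) : C :=
  iota (T := C_R_CompleteNormedModule) (is_outgoing G v th).

Definition ex_lateral (G : contour) (v : C -> C) (th : R) : Prop :=
  (exists l, is_incoming G v th l) /\ (exists l, is_outgoing G v th l).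

Definition jump (G : contour) (v : C -> C) (th : R) : C :=
  (outgoing G v th - incoming G v th)%C.

(* Membership in PH_sigma(Gamma, D). Functions on Gamma are functions on C of which
   only the values on Gamma matter. *)
Record PH (G : contour) (D : jump_set) (sigma : R) (v : C -> C) : Prop := {
  PH_holder : forall j, (1 <= j <= nd D)%nat ->
    exists H : R, forall a b, in_arc D j a -> in_arc D j b ->
      Cmod (v (G a) - v (G b))%C <= H * rpow (arc_dist G D a b) sigma;
  PH_lateral : forall j, (1 <= j <= nd D)%nat -> ex_lateral G v (angle D j);
  PH_incoming : forall j, (1 <= j <= nd D)%nat ->
    v (G (angle D j)) = incoming G v (angle D j)
}.

Record kernel_regular (G : contour) (mu : R) (k : C -> C -> C) : Prop := {
  kernel_bounded : exists M0 : R, forall t tau,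
    on_contour G t -> on_contour G tau -> Cmod (k t tau) <= M0;
  kernel_holder : exists Mmu : R, forall t s tau,
    on_contour G t -> on_contour G s -> on_contour G tau ->
    Cmod (k t tau - k s tau)%C <= Mmu * rpow (Cmod (t - s)%C) mu;
  kernel_modulus : exists omega : R -> R,
    filterlim omega (at_right 0) (locally 0) /\
    forall t tau zeta, on_contour G t -> on_contour G tau -> on_contour G zeta ->
      Cmod (k t tau - k t zeta)%C <= omega (Cmod (tau - zeta)%C)
}.

Definition opK (G : contour) (k : C -> C -> C) (v : C -> C) (t : C) : C :=
  RInt (V := C_R_CompleteNormedModule)
    (fun th => (k t (G th) * v (G th) * dgam G th)%C) 0 (2 * PI).

Definition opA (G : contour) (k : C -> C -> C) (lambda : C) (v : C -> C) (t : C) : C :=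
  (v t - lambda * opK G k v t)%C.

(* Main.v *)
(* A function v in PH is bounded and Riemann integrable along the contour, so the
   Holder continuity of k in its first variable passes to K v. Hence K v is continuous
   at the points of D and subtracting lambda K v leaves the jumps of v unchanged. *)
Require Import Defs.
From Stdlib Require Import Reals Lra Lia.
From Coquelicot Require Import Coquelicot.
Open Scope R_scope.

(** * Limits in the complex plane and Hölder estimates *)

(** The plane carries two uniform structures, the product one used by [locally] and the one whose
    balls are discs for [Cmod]. They have the same neighbourhoods, and [locally_C] passes from one
    to the other. *)
Lemma filterlim_Cmod {T : Type} {F : (T -> Prop) -> Prop} {FF : Filter F}
  (f : T -> C) (l : C) :
  filterlim f F (locally l) <->
  forall eps : R, 0 < eps -> F (fun x => Cmod (f x - l)%C < eps).
Proof.
  split.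
  - intros Hf eps Heps.
    assert (Hf' : filterlim f F (locally (T := AbsRing_UniformSpace C_AbsRing) l)).
    { intros P HP. apply Hf. now apply locally_C. }
    exact (proj1 (filterlim_locally (U := AbsRing_UniformSpace C_AbsRing) f l) Hf'
             (mkposreal eps Heps)).
  - intros H.
    assert (Hf' : filterlim f F (locally (T := AbsRing_UniformSpace C_AbsRing) l)).
    { apply (filterlim_locally (U := AbsRing_UniformSpace C_AbsRing)).
      intros eps. exact (H eps (cond_pos eps)). }
    intros P HP. apply Hf'. now apply locally_C.
Qed.

Lemma filterlim_Cmult {T : Type} {F : (T -> Prop) -> Prop} {FF : Filter F}
  (f g : T -> C) (l m : C) :
  filterlim f F (locally l) -> filterlim g F (locally m) ->
  filterlim (fun x => (f x * g x)%C) F (locally (l * m)%C).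
Proof.
  intros Hf Hg P HP.
  assert (Hf' : filterlim f F (locally (T := AbsRing_UniformSpace C_AbsRing) l)).
  { intros Q HQ. apply Hf. now apply locally_C. }
  assert (Hg' : filterlim g F (locally (T := AbsRing_UniformSpace C_AbsRing) m)).
  { intros Q HQ. apply Hg. now apply locally_C. }
  apply (filterlim_comp_2 f g Cmult Hf' Hg' (filterlim_mult (K := C_AbsRing) l m)).
  now apply locally_C.
Qed.

Lemma filterlim_Cminus {T : Type} {F : (T -> Prop) -> Prop} {FF : Filter F}
  (f g : T -> C) (l m : C) :
  filterlim f F (locally l) -> filterlim g F (locally m) ->
  filterlim (fun x => (f x - g x)%C) F (locally (l - m)%C).
Proof.
  intros Hf Hg.
  exact (filterlim_comp_2 f (fun x => Copp (g x)) Cplus Hf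
    (filterlim_comp _ _ _ g Copp _ _ _ Hg (filterlim_opp (V := C_R_NormedModule) m))
    (filterlim_plus (V := C_R_NormedModule) l (- m)%C)).
Qed.

Lemma rpow_lt (x s eps : R) :
  0 <= x -> 0 < s -> 0 < eps -> x < Rpower eps (/ s) -> rpow x s < eps.
Proof.
  intros Hx Hs Heps Hlt. unfold rpow. destruct (Req_EM_T x 0) as [|Hne]; [easy|].
  apply Rlt_le_trans with (Rpower (Rpower eps (/ s)) s).
  - unfold Rpower at 1 2. apply exp_increasing, Rmult_lt_compat_l; [easy|].
    apply ln_increasing; lra.
  - rewrite Rpower_mult, Rinv_l, Rpower_1 by lra. lra.
Qed.

Lemma rpow_ge0 (x s : R) : 0 <= rpow x s.
Proof.
  unfold rpow. destruct (Req_EM_T x 0); [lra|]. apply Rlt_le, exp_pos.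
Qed.

(** An arbitrary filter and an abstract distance [h] let this serve both for [v] with the arc
    distance and for the image of [opK] with the chord length. *)
Lemma filterlim_holder {T : Type} {F : (T -> Prop) -> Prop} {FF : Filter F}
  (f : T -> C) (l : C) (h : T -> R) (H s : R) :
  0 < s -> (forall x, 0 <= h x) -> filterlim h F (locally 0) ->
  F (fun x => Cmod (f x - l)%C <= H * rpow (h x) s) ->
  filterlim f F (locally l).
Proof.
  intros Hs Hh0 Hh Hle. apply filterlim_Cmod. intros eps Heps.
  assert (HH := Rabs_pos H).
  (* Neither the sign of [H] nor its being nonzero is known, hence the denominator [Rabs H + 1]. *)
  assert (Hd : 0 < eps / (Rabs H + 1)) by (apply Rdiv_lt_0_compat; lra).
  set (d := eps / (Rabs H + 1)) in *.
  (* The radius is [Rpower d (/ s)] unfolded, the threshold of [rpow_lt]. *)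
  assert (Hsmall := proj1 (filterlim_locally h 0) Hh (mkposreal _ (exp_pos (/ s * ln d)))).
  generalize (filter_and _ _ Hle Hsmall). apply filter_imp.
  intros x [H1 H2]. simpl in H2.
  assert (Hr : rpow (h x) s < d).
  { apply rpow_lt; [easy..|]. unfold ball in H2; simpl in H2.
    unfold AbsRing_ball, abs, minus, plus, opp in H2; simpl in H2.
    apply Rle_lt_trans with (2 := H2). rewrite Ropp_0, Rplus_0_r. apply Rle_abs. }
  apply Rle_lt_trans with (1 := H1).
  apply Rle_lt_trans with (Rabs H * rpow (h x) s).
  - apply Rmult_le_compat_r; [apply rpow_ge0|apply Rle_abs].
  - apply Rle_lt_trans with (Rabs H * d).
    + apply Rmult_le_compat_l; lra.
    + assert (Heq : (Rabs H + 1) * d = eps) by (unfold d; field; lra). lra.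
Qed.

(** * Integrability of functions with lateral limits *)

(* The test function [q] lets the same property of [v] serve for all the kernels
   [k t] at once. *)
Definition piecewise_integrable (u : R -> C) (a b : R) : Prop :=
  (exists B, forall x, a <= x <= b -> Cmod (u x) <= B) /\
  forall q : R -> C, (forall x, continuous q x) ->
    ex_RInt (V := C_R_NormedModule) (fun x => (q x * u x)%C) a b.

Lemma piecewise_integrable_chain (u : R -> C) (a b c : R) :
  piecewise_integrable u a b -> piecewise_integrable u b c ->
  piecewise_integrable u a c.
Proof.
  intros [[B1 HB1] H1] [[B2 HB2] H2]. split.
  - exists (Rmax B1 B2). intros x Hx. destruct (Rle_dec x b).
    + apply Rle_trans with (2 := Rmax_l _ _). apply HB1; lra.
    + apply Rle_trans with (2 := Rmax_r _ _). apply HB2; lra.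
  - intros q Hq. apply ex_RInt_Chasles with b; [now apply H1|now apply H2].
Qed.

(** The lateral limits extend [u] from the open interval to a continuous [w] on the whole line. The
    integral does not see the values of [u] at [a] and [b], about which nothing is assumed; they
    only enter the bound. *)
Lemma piecewise_integrable_lateral (u : R -> C) (a b : R) (la lb : C) :
  a < b -> (forall c, a < c < b -> continuous u c) ->
  filterlim u (at_right a) (locally la) -> filterlim u (at_left b) (locally lb) ->
  piecewise_integrable u a b.
Proof.
  intros Hab Hc Ha Hb.
  destruct (C0_extension_lt u la lb a b Hab Hc Ha Hb) as [w [Hw [Hwu _]]].
  split.
  - destruct (bounded_continuity (V := C_R_NormedModule) w a b (fun x _ => Hw x)) as [M HM].
    exists (Rmax M (Rmax (Cmod (u a)) (Cmod (u b)))). intros x Hx.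
    destruct (Req_dec x a) as [->|Hxa].
    { apply Rle_trans with (2 := Rmax_r _ _), Rmax_l. }
    destruct (Req_dec x b) as [->|Hxb].
    { apply Rle_trans with (2 := Rmax_r _ _), Rmax_r. }
    apply Rle_trans with (2 := Rmax_l _ _). rewrite <- Hwu by lra.
    apply Rlt_le. rewrite Cmod_norm. now apply HM.
  - intros q Hq. apply ex_RInt_ext with (fun x => (q x * w x)%C).
    + intros x. rewrite Rmin_left, Rmax_right by lra. intros Hx. now rewrite Hwu.
    + apply (ex_RInt_continuous (V := C_R_CompleteNormedModule)).
      intros z _. now apply filterlim_Cmult; [apply Hq|apply Hw].
Qed.

(** * Functions of the space along the contour *)

Lemma contour_continuous (G : contour) (th : R) : continuous (gam G) th.
Proof.
  apply (ex_derive_continuous (V := C_R_NormedModule)).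
  exists (dgam G th). apply gam_derive.
Qed.

Lemma dgam_continuous (G : contour) (th : R) : continuous (dgam G) th.
Proof.
  apply (ex_derive_continuous (V := C_R_NormedModule)).
  exists (ddgam G th). apply dgam_derive.
Qed.

Lemma contour_Cmod_lim (G : contour) (c : R) :
  filterlim (fun x => Cmod (G x - G c)%C) (locally c) (locally 0).
Proof.
  apply filterlim_locally. intros eps.
  generalize (proj1 (filterlim_Cmod G (G c)) (contour_continuous G c) eps (cond_pos eps)).
  apply filter_imp. intros x Hx. unfold ball; simpl.
  unfold AbsRing_ball, abs, minus, plus, opp; simpl.
  rewrite Ropp_0, Rplus_0_r, Rabs_pos_eq; [easy|apply Cmod_ge_0].
Qed.

Lemma arc_dist_ge0 (G : contour) (D : jump_set) (a b : R) : 0 <= arc_dist G D a b.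
Proof.
  unfold arc_dist. destruct (Nat.eqb (nd D) 1); [apply Rabs_pos|apply Cmod_ge_0].
Qed.

(** For a single jump point the distance is an integral with a varying bound, hence continuous in
    that bound and zero at [c]. Otherwise it is a chord, and the continuity of the contour
    suffices. *)
Lemma arc_dist_lim (G : contour) (D : jump_set) (c : R) :
  filterlim (fun x => arc_dist G D x c) (locally c) (locally 0).
Proof.
  unfold arc_dist. destruct (Nat.eqb (nd D) 1); [|apply contour_Cmod_lim].
  assert (Hcont : forall z, continuous (fun th => Cmod (dgam G th)) z).
  { intros z. apply (continuous_comp (dgam G) Cmod); [apply dgam_continuous|].
    unfold continuous. rewrite Cmod_norm.
    apply (filterlim_ext (FF := filter_filter (F := locally (T := C_UniformSpace) (dgam G z)))
             (norm (V := C_R_NormedModule))).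
    - intros x. symmetry. apply Cmod_norm.
    - exact (filterlim_norm (V := C_R_NormedModule) (dgam G z)). }
  assert (H : continuous (fun x => RInt (fun th => Cmod (dgam G th)) x c) c).
  { apply (continuous_RInt_2 (fun th => Cmod (dgam G th)) c c).
    apply filter_forall. intros z. apply (RInt_correct (V := R_CompleteNormedModule)).
    apply (ex_RInt_continuous (V := R_CompleteNormedModule)). intros; apply Hcont. }
  assert (H' := continuous_comp _ Rabs c H (continuous_Rabs _)).
  unfold continuous in H'. rewrite RInt_point in H'.
  unfold zero in H'; simpl in H'. now rewrite Rabs_R0 in H'.
Qed.

Lemma arc_continuous (G : contour) (D : jump_set) (s : R) (v : C -> C) (j : nat) (c : R) :
  0 < s -> PH G D s v -> (1 <= j <= nd D)%nat -> in_arc D j c ->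
  continuous (fun th => v (G th)) c.
Proof.
  intros Hs Hv Hj Hc. destruct (PH_holder _ _ _ _ Hv j Hj) as [H HH].
  apply filterlim_holder with (fun x => arc_dist G D x c) H s; [easy| | |].
  - intros x. apply arc_dist_ge0.
  - apply arc_dist_lim.
  (* The parameter interval of an arc is open, so the Hölder bound holds throughout a neighbourhood
     of [c]. *)
  - generalize (open_and _ _ (open_gt (angle D j)) (open_lt (arc_end D j)) c Hc).
    apply filter_imp. intros x Hx. now apply HH.
Qed.

Lemma angle_bounds (D : jump_set) (j : nat) :
  (1 <= j <= nd D)%nat -> angle D 1 <= angle D j <= angle D (nd D).
Proof.
  intros Hj. split.
  - destruct Hj as [H1 H2]. induction H1 as [|m Hm IH]; [lra|].
    apply Rle_trans with (1 := IH ltac:(lia)). apply Rlt_le, angle_incr. lia.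
  - destruct Hj as [H1 H2].
    enough (H : forall m, (j <= m)%nat -> (m <= nd D)%nat -> angle D j <= angle D m)
      by now apply H.
    intros m Hm. induction Hm as [|m Hm IH]; intros Hn; [lra|].
    apply Rle_trans with (1 := IH ltac:(lia)). apply Rlt_le, angle_incr. lia.
Qed.

(** The period is split at the first and the last jump angle. Both outer pieces lie on the arc that
    crosses the cut; the middle one is a chain of the other arcs and shrinks to a point when there
    is a single jump. *)
Lemma piecewise_integrable_PH (G : contour) (D : jump_set) (s : R) (v : C -> C) :
  0 < s -> PH G D s v -> piecewise_integrable (fun th => v (G th)) 0 (2 * PI).
Proof.
  intros Hs Hv.
  assert (Hn := nd_pos D). assert (H1 := angle_gt0 D). assert (H2 := angle_lt D).
  assert (H12 := angle_bounds D 1 ltac:(lia)).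
  assert (Hend : arc_end D (nd D) = angle D 1 + 2 * PI)
    by (unfold arc_end; now rewrite Nat.eqb_refl).
  assert (Hlast : forall c, angle D (nd D) < c < angle D 1 + 2 * PI ->
            continuous (fun th => v (G th)) c).
  { intros c Hc. apply arc_continuous with D s (nd D); [easy|easy|lia|].
    unfold in_arc. now rewrite Hend. }
  (* The part of the last arc behind the cut is covered by periodicity. *)
  assert (Hfirst : forall c, angle D (nd D) - 2 * PI < c < angle D 1 ->
            continuous (fun th => v (G th)) c).
  { intros c Hc.
    apply continuous_ext with (fun th => v (G (th + 2 * PI))).
    - intros x. now rewrite gam_periodic.
    - apply (continuous_comp (fun th => th + 2 * PI) (fun th => v (G th))).
      + apply (continuous_plus (V := R_NormedModule));
          [apply continuous_id|apply continuous_const].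
      + apply Hlast. lra. }
  apply piecewise_integrable_chain with (angle D 1);
    [|apply piecewise_integrable_chain with (angle D (nd D))].
  - destruct (PH_lateral _ _ _ _ Hv 1 ltac:(lia)) as [[l Hl] _].
    (* The cut is not a jump point, so the limit there is the value of [v]. *)
    apply piecewise_integrable_lateral with (v (G 0)) l; [lra| | |easy].
    + intros c Hc. apply Hfirst. lra.
    + apply filterlim_filter_le_1 with (2 := Hfirst 0 ltac:(lra)).
      apply filter_le_within.
  - enough (H : forall m, (1 <= m)%nat -> (m <= nd D)%nat ->
              piecewise_integrable (fun th => v (G th)) (angle D 1) (angle D m))
      by now apply H.
    intros m Hm. induction Hm as [|m Hm IH]; intros Hmn.
    + split.
      * exists (Cmod (v (G (angle D 1)))). intros x Hx.
        replace x with (angle D 1) by lra. lra.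
      * intros. apply ex_RInt_point.
    + apply piecewise_integrable_chain with (1 := IH ltac:(lia)).
      destruct (PH_lateral _ _ _ _ Hv m ltac:(lia)) as [_ [la Hla]].
      destruct (PH_lateral _ _ _ _ Hv (S m) ltac:(lia)) as [[lb Hlb] _].
      apply piecewise_integrable_lateral with la lb; [|  |easy|easy].
      * apply angle_incr. lia.
      * intros c Hc. apply arc_continuous with D s m; [easy|easy|lia|].
        (* Here [m < nd D], so the arc ends at the next angle without wrapping around. *)
        unfold in_arc, arc_end. now rewrite (proj2 (Nat.eqb_neq _ _)) by lia.
  - destruct (PH_lateral _ _ _ _ Hv (nd D) ltac:(lia)) as [_ [l Hl]].
    apply piecewise_integrable_lateral with l (v (G (2 * PI))); [lra| |easy|].
    + intros c Hc. apply Hlast. lra.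
    + apply filterlim_filter_le_1 with (2 := Hlast (2 * PI) ltac:(lra)).
      apply filter_le_within.
Qed.

(** * Continuity of the integral operator *)

(** This makes the kernel times [dgam] a continuous test function for [piecewise_integrable]. *)
Lemma kernel_continuous (G : contour) (mu : R) (k : C -> C -> C) (t : C) (c : R) :
  kernel_regular G mu k -> on_contour G t -> continuous (fun th => k t (G th)) c.
Proof.
  intros Hk Ht. destruct (kernel_modulus _ _ _ Hk) as [om [Hom Hkom]].
  apply filterlim_Cmod. intros eps Heps.
  destruct (proj1 (filterlim_locally om 0) Hom (mkposreal eps Heps)) as [d Hd].
  generalize (proj1 (filterlim_Cmod G (G c)) (contour_continuous G c) d (cond_pos d)).
  apply filter_imp. intros x Hx.
  (* [omega] is unconstrained at [0]. *)
  destruct (Req_dec (Cmod (G x - G c)%C) 0) as [H0|Hne].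
  - apply Cmod_eq_0 in H0.
    replace (G x) with (G c) by (rewrite <- (Cplus_0_r (G c)), <- H0; ring).
    replace (k t (G c) - k t (G c))%C with (RtoC 0) by ring. now rewrite Cmod_0.
  - assert (Hge := Cmod_ge_0 (G x - G c)%C).
    apply Rle_lt_trans with (om (Cmod (G x - G c)%C)).
    + apply Hkom; [easy|now exists x|now exists c].
    + assert (Hb : ball 0 eps (om (Cmod (G x - G c)%C))).
      { apply Hd; [|lra]. unfold ball; simpl.
        unfold AbsRing_ball, abs, minus, plus, opp; simpl.
        now rewrite Ropp_0, Rplus_0_r, Rabs_pos_eq. }
      unfold ball in Hb; simpl in Hb.
      unfold AbsRing_ball, abs, minus, plus, opp in Hb; simpl in Hb.
      rewrite Ropp_0, Rplus_0_r in Hb. apply Rle_lt_trans with (2 := Hb), Rle_abs.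
Qed.

Lemma opK_holder (G : contour) (D : jump_set) (s mu : R) (k : C -> C -> C) (v : C -> C) :
  0 < s -> kernel_regular G mu k -> PH G D s v ->
  exists H : R, forall t t', on_contour G t -> on_contour G t' ->
    Cmod (opK G k v t - opK G k v t')%C <= H * rpow (Cmod (t - t')%C) mu.
Proof.
  intros Hs Hk Hv.
  destruct (piecewise_integrable_PH G D s v Hs Hv) as [[B HB] Hint].
  destruct (bounded_continuity (V := C_R_NormedModule) (dgam G) 0 (2 * PI)
              (fun x _ => dgam_continuous G x)) as [M HM].
  destruct (kernel_holder _ _ _ Hk) as [Mmu Hmu].
  assert (Hpi := PI_RGT_0).
  (* Length of the parameter interval, Hölder constant of the kernel, bound of [v] and bound of
     [dgam]. *)
  exists (2 * PI * Mmu * B * M). intros t t' Ht Ht'.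
  assert (Hex : forall z, on_contour G z ->
    ex_RInt (V := C_R_NormedModule)
      (fun th => (k z (G th) * v (G th) * dgam G th)%C) 0 (2 * PI)).
  { intros z Hz.
    (* The factors are reordered to separate the continuous part [q] from [v]. *)
    apply ex_RInt_ext with (fun th => (k z (G th) * dgam G th * v (G th))%C).
    - intros. change (@eq C (k z (G x) * dgam G x * v (G x))%C
        (k z (G x) * v (G x) * dgam G x)%C). ring.
    - apply Hint. intros x.
      apply filterlim_Cmult; [now apply kernel_continuous with mu|apply dgam_continuous]. }
  assert (HI := is_RInt_minus (V := C_R_NormedModule) _ _ _ _ _ _
    (RInt_correct (V := C_R_CompleteNormedModule) _ _ _ (Hex t Ht))
    (RInt_correct (V := C_R_CompleteNormedModule) _ _ _ (Hex t' Ht'))).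
  apply (norm_RInt_le_const (V := C_R_NormedModule)) with
    (M := Mmu * rpow (Cmod (t - t')%C) mu * B * M) in HI.
  - rewrite Cmod_norm. unfold opK.
    apply Rle_trans with (1 := HI). right; ring.
  - lra.
  - intros x Hx. rewrite <- Cmod_norm.
    change (Cmod (k t (G x) * v (G x) * dgam G x - k t' (G x) * v (G x) * dgam G x)%C <=
      Mmu * rpow (Cmod (t - t')%C) mu * B * M).
    replace (k t (G x) * v (G x) * dgam G x - k t' (G x) * v (G x) * dgam G x)%C
      with ((k t (G x) - k t' (G x)) * v (G x) * dgam G x)%C by ring.
    rewrite !Cmod_mult.
    apply Rmult_le_compat.
    + apply Rmult_le_pos; apply Cmod_ge_0.
    + apply Cmod_ge_0.
    + apply Rmult_le_compat; [apply Cmod_ge_0..| |now apply HB].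
      apply Hmu; [easy|easy|now exists x].
    + rewrite Cmod_norm. now apply Rlt_le, HM.
Qed.

Lemma opK_continuous (G : contour) (D : jump_set) (s mu : R) (k : C -> C -> C)
  (v : C -> C) (c : R) :
  0 < s -> 0 < mu -> kernel_regular G mu k -> PH G D s v ->
  continuous (fun th => opK G k v (G th)) c.
Proof.
  intros Hs Hmu Hk Hv. destruct (opK_holder G D s mu k v Hs Hk Hv) as [H HH].
  apply filterlim_holder with (fun x => Cmod (G x - G c)%C) H mu; [easy| | |].
  - intros x. apply Cmod_ge_0.
  - apply contour_Cmod_lim.
  - apply filter_forall. intros x. apply HH; [now exists x|now exists c].
Qed.

(** * Jumps *)

(** One-sided limits are unique, so [iota] returns the given ones. *)
Lemma jump_eq (G : contour) (v : C -> C) (th : R) (l m : C) :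
  is_incoming G v th l -> is_outgoing G v th m -> jump G v th = (m - l)%C.
Proof.
  intros Hl Hm. unfold jump. f_equal; [|f_equal].
  - exact (iota_filterlim_locally (V := C_R_CompleteNormedModule) _ m Hm).
  - exact (iota_filterlim_locally (V := C_R_CompleteNormedModule) _ l Hl).
Qed.

(** An arbitrary [f] that agrees with the image of [v] on the contour covers both claims of the
    theorem: [f] may be that image itself or a given right-hand side. *)
Lemma jump_opA (G : contour) (D : jump_set) (s mu : R) (k : C -> C -> C) (lambda : C)
  (v f : C -> C) :
  0 < s -> 0 < mu -> kernel_regular G mu k -> PH G D s v ->
  (forall t, on_contour G t -> opA G k lambda v t = f t) ->
  forall j, (1 <= j <= nd D)%nat ->
    ex_lateral G f (angle D j) /\ jump G f (angle D j) = jump G v (angle D j).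
Proof.
  intros Hs Hmu Hk Hv Hf j Hj.
  destruct (PH_lateral _ _ _ _ Hv j Hj) as [[l Hl] [m Hm]].
  set (th := angle D j) in *.
  set (w := (lambda * opK G k v (G th))%C).
  (* By continuity of [opK] along the contour, every limit of [v] at [th], from either side, is
     shifted by the same constant [w], which cancels in the jump. *)
  assert (HA : forall (F : (R -> Prop) -> Prop) (z : C), Filter F ->
    filter_le F (locally th) -> filterlim (fun x => v (G x)) F (locally z) ->
    filterlim (fun x => f (G x)) F (locally (z - w)%C)).
  { intros F z FF HF Hz.
    apply filterlim_ext with (fun x => (v (G x) - lambda * opK G k v (G x))%C).
    - intros x. apply Hf. now exists x.
    - apply filterlim_Cminus; [easy|].
      apply filterlim_Cmult; [apply filterlim_const|].
      apply filterlim_filter_le_1 with (1 := HF).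
      exact (opK_continuous G D s mu k v th Hs Hmu Hk Hv). }
  assert (Hin : is_incoming G f th (l - w)%C)
    by (apply HA; [apply at_left_proper_filter|apply filter_le_within|easy]).
  assert (Hout : is_outgoing G f th (m - w)%C)
    by (apply HA; [apply at_right_proper_filter|apply filter_le_within|easy]).
  split.
  - split; eexists; eassumption.
  - rewrite (jump_eq _ _ _ _ _ Hin Hout), (jump_eq _ _ _ _ _ Hl Hm). ring.
Qed.

Theorem proposition3p5
  (G : contour) (D : jump_set) (alpha beta mu : R) (k : C -> C -> C) (lambda : C)
  (hbeta : 0 < beta) (hbeta_alpha : beta < alpha) (halpha_mu : alpha < mu) (hmu : mu <= 1)
  (hk : kernel_regular G mu k) :
  (forall v : C -> C, PH G D beta v ->
     forall j, (1 <= j <= nd D)%nat ->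
       ex_lateral G (opA G k lambda v) (angle D j) /\
       jump G (opA G k lambda v) (angle D j) = jump G v (angle D j)) /\
  (forall phi f : C -> C, PH G D beta phi ->
     (forall t, on_contour G t -> opA G k lambda phi t = f t) ->
     forall j, (1 <= j <= nd D)%nat ->
       ex_lateral G f (angle D j) /\
       jump G phi (angle D j) = jump G f (angle D j)).
Proof.
  split.
  (* Here [f] is [opA G k lambda v], and the equation holds by reflexivity. *)
  - intros v Hv. now apply (jump_opA G D beta mu k lambda); [|lra|..].
  - intros phi f Hphi Hf j Hj.
    destruct (jump_opA G D beta mu k lambda phi f) with (j := j) as [Hex Heq];
      [easy|lra|easy..|].
    now split.
Qed.
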